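(* Let $f(x,y) = Cx^2 + Dy^2$ with $C, D \in \mathbb{Q}$ nonzero. Then $f$ has a rational periodic vector of type $(L,L)$ (and hence has infinitely many) if and only if there exist rational numbers $m, n$ with $m \neq 0$ such that $$CD = -\frac{n^2+3}{4m^2}.$$
   Context: For $f : \mathbb{Q}^2 \to \mathbb{Q}$ define $f_L : \mathbb{Q}^2 \to \mathbb{Q}^2$ by $f_L(x,y) = (f(x,y), y)$. A rational periodic vector of type $(L,L)$ for $f$ is a vector $\overline{v} \in \mathbb{Q}^2$ with $f_L(f_L(\overline{v})) = \overline{v}$ and $f_L(\overline{v}) \neq \overline{v}$. The parenthetical ''and hence has infinitely many'' means that if $f$ has one rational periodic vector of type $(L,L)$, then it has infinitely many. *)

(* Defs.v *)
From mathcomp Require Import all_boot all_order all_algebra.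
Set Implicit Arguments.
Unset Strict Implicit.
Unset Printing Implicit Defensive.
Import Order.TTheory GRing.Theory Num.Theory.
Local Open Scope ring_scope.

Definition mapL (f : rat * rat -> rat) (v : rat * rat) : rat * rat :=
  (f v, v.2).

Definition periodic_LL (f : rat * rat -> rat) (v : rat * rat) : Prop :=
  mapL f (mapL f v) = v /\ mapL f v <> v.

Definition diag_form (C D : rat) (v : rat * rat) : rat :=
  C * v.1 ^+ 2 + D * v.2 ^+ 2.

(* Main.v *)
Require Import Defs.
From mathcomp Require Import all_boot all_order all_algebra.
From mathcomp Require Import boolp classical_sets functions cardinality.
From mathcomp Require Import ring lra.
Set Implicit Arguments.
Unset Strict Implicit.
Unset Printing Implicit Defensive.
Import Order.TTheory GRing.Theory Num.Theory.
Local Open Scope classical_set_scope.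
Local Open Scope ring_scope.

(** If [x != x'] are exchanged by [t |-> C t^2 + D y^2], subtracting the two
    equations [x' = C x^2 + D y^2] and [x = C x'^2 + D y^2] and dividing by
    [x - x'] gives [x' = - x - 1 / C].  What remains, after completing the
    square with [n = 2 C x + 1], is a point of the conic
    [n^2 + 3 = - 4 C D y^2], and [x != x'] becomes [n != 0]
    ([periodic_LLP]).  On this conic [y] cannot vanish, whence the formula
    for [C D].

    The converse has to produce a point with [n != 0] from a point that may
    have [n = 0], and then infinitely many of them.  Put [A = - 4 C D > 0] and
    read the conic as the set of elements of norm [- 3] in the algebra
    obtained from the rationals by adjoining a square root of [A]; it is
    stable under multiplication by elements of norm 1
    ([conic_rot_norm]).  Those are parametrized by a rational [w].  Starting
    from a point with [n >= 0] and [y > 0], which is only a matter of signs,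
    all [w > 0] with [A w^2 > 1] give points with [n > 0]
    ([conic_rot1_gt0]), and these points are distinct because their second
    coordinate decreases with [w] ([conic_rot2_decr]). *)

(** Here [x] and its image [z] are the roots of a quadratic with sum
    [- 1 / C]; completing the square turns it into the conic, and
    [2 C x + 1 = 0] says that they coincide. *)
Lemma periodic_LLP (C D x y : rat) : C != 0 ->
  periodic_LL (diag_form C D) (x, y) <->
  (2 * C * x + 1) ^+ 2 + 3 = - (4 * (C * D)) * y ^+ 2 /\ 2 * C * x + 1 != 0.
Proof.
move=> C0; rewrite /periodic_LL /mapL /diag_form /=.
have [z zE] : exists z, z = C * x ^+ 2 + D * y ^+ 2 by eexists.
rewrite -zE; split=> [[[zx] neq]|[conic n0]].
  have zNx : z - x != 0.
    by rewrite subr_eq0; apply/eqP => e; apply: neq; rewrite e.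
  have sum_zx : C * (z + x) + 1 = 0 by apply: (mulfI zNx); lra.
  split; first by rewrite zE in sum_zx; lra.
  by apply: contra_neq zNx => n0; apply: (mulfI C0); lra.
have sum_zx : C * z = - C * x - 1 by rewrite zE; lra.
split.
  congr pair; apply: (mulfI C0).
  have -> : C * (C * z ^+ 2 + D * y ^+ 2) = (C * z) ^+ 2 + C * z - (C * x) ^+ 2.
    by have := congr1 ( *%R C) zE; lra.
  by rewrite sum_zx; ring.
by move=> [zx]; move/eqP: n0; apply; rewrite zx in sum_zx; lra.
Qed.

(** Coordinates of the product of [n + m sqrt A] by the element
    [(w sqrt A + 1) / (w sqrt A - 1)] of norm 1. *)
Definition conic_rot1 (R : fieldType) (A n m w : R) : R :=
  (n * (A * w ^+ 2 + 1) + 2 * A * m * w) / (A * w ^+ 2 - 1).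

Definition conic_rot2 (R : fieldType) (A n m w : R) : R :=
  (m * (A * w ^+ 2 + 1) + 2 * n * w) / (A * w ^+ 2 - 1).

Lemma conic_rot_norm (R : fieldType) (A n m w : R) : A * w ^+ 2 - 1 != 0 ->
  conic_rot1 A n m w ^+ 2 - A * conic_rot2 A n m w ^+ 2 = n ^+ 2 - A * m ^+ 2.
Proof. by move=> w0; rewrite /conic_rot1 /conic_rot2; field. Qed.

Lemma conic_rot1_gt0 (R : realFieldType) (A n m w : R) :
  0 < A -> 0 <= n -> 0 < m -> 0 < w -> 0 < A * w ^+ 2 - 1 ->
  0 < conic_rot1 A n m w.
Proof.
move=> A0 n0 m0 w0 Aw; rewrite divr_gt0// ltr_wpDl//.
  by rewrite mulr_ge0//; lra.
by rewrite !mulr_gt0.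
Qed.

(** Up to the constant [m], the second coordinate is
    [2 (n w + m) / (A w^2 - 1)]. *)
Lemma conic_rot2_decr (R : realFieldType) (A n m a b : R) :
  0 < A -> 0 <= n -> 0 < m -> 0 < a -> a < b -> 0 < A * a ^+ 2 - 1 ->
  conic_rot2 A n m b < conic_rot2 A n m a.
Proof.
move=> A0 n0 m0 a0 ab Aa.
have b0 : 0 < b := lt_trans a0 ab.
have Ab : 0 < A * b ^+ 2 - 1.
  rewrite (lt_trans Aa)// ltrD2r ltr_pM2l// ltr_pXn2r// nnegrE; exact: ltW.
rewrite -subr_gt0.
have -> : conic_rot2 A n m a - conic_rot2 A n m b =
    2 * (b - a) * (n * (A * a * b + 1) + m * A * (a + b)) /
    ((A * a ^+ 2 - 1) * (A * b ^+ 2 - 1)).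
  by rewrite /conic_rot2; field; rewrite !gt_eqF.
have ba : 0 < b - a by rewrite subr_gt0.
rewrite divr_gt0 ?mulr_gt0// ltr_wpDl//.
  by rewrite mulr_ge0// addr_ge0// !mulr_ge0// ltW.
by rewrite !mulr_gt0// addr_gt0.
Qed.

(** The periodic vectors come from the rotations of [(|n|, |m|)] by an
    increasing sequence of parameters; this gives both the existence of a
    periodic vector, even for [n = 0], and infinitely many of them. *)
Lemma periodic_LL_seq (C D m n : rat) : C != 0 -> m != 0 ->
  C * D = - ((n ^+ 2 + 3) / (4 * m ^+ 2)) ->
  exists2 v : nat -> rat * rat,
    injective v & forall k, periodic_LL (diag_form C D) (v k).
Proof.
move=> C0 m0 CD; pose A := - (4 * (C * D)).
have conic : `|n| ^+ 2 - A * `|m| ^+ 2 = - 3.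
  by rewrite !real_normK ?num_real// /A CD; field.
have nm_gt0 : 0 < `|m| by rewrite normr_gt0.
have A0 : 0 < A.
  rewrite -(pmulr_lgt0 _ (exprn_gt0 2 nm_gt0)).
  have := sqr_ge0 `|n|; lra.
(* Starting at 1 + 1 / A ensures A w^2 > 1. *)
pose w k : rat := k%:R + (1 + A^-1).
have w0 k : 0 < w k by rewrite ltr_wpDl// addr_gt0// invr_gt0.
have Aw k : 0 < A * w k ^+ 2 - 1.
  have w1 : 1 < w k by rewrite ltr_wpDl// ltrDl invr_gt0.
  have Aw1 : 1 < A * w k.
    rewrite /w !mulrDr mulfV ?gt_eqF// mulr1 addrA ltrDr.
    by rewrite ltr_wpDl// mulr_ge0// ltW.
  by rewrite subr_gt0 expr2 mulrA (lt_trans Aw1)// ltr_pMr// (lt_trans _ Aw1).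
pose p k := conic_rot1 A `|n| `|m| (w k).
pose q k := conic_rot2 A `|n| `|m| (w k).
have q_decr i j : (i < j)%N -> q j < q i.
  by move=> ij; apply: conic_rot2_decr => //; rewrite ltrD2r ltr_nat.
exists (fun k => ((p k - 1) / (2 * C), q k)).
  move=> i j [_ qij]; case: (ltngtP i j) => // /q_decr;
  by rewrite qij ltxx.
move=> k; apply/(periodic_LLP _ _ _ C0).
have -> : 2 * C * ((p k - 1) / (2 * C)) + 1 = p k by field.
split; last by rewrite gt_eqF// conic_rot1_gt0.
have norm_pq := conic_rot_norm `|n| `|m| (negbT (gt_eqF (Aw k))).
by apply/eqP; rewrite -subr_eq0 addrAC norm_pq conic addNr.
Qed.

Theorem proposition3p6 (C D : rat) (hC : C != 0) (hD : D != 0) :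
  ((exists v : rat * rat, periodic_LL (diag_form C D) v) <->
   (exists m n : rat, m != 0 /\ C * D = - ((n ^+ 2 + 3) / (4 * m ^+ 2)))) /\
  ((exists v : rat * rat, periodic_LL (diag_form C D) v) ->
   infinite_set [set v : rat * rat | periodic_LL (diag_form C D) v]).
Proof.
have to_conic : (exists v, periodic_LL (diag_form C D) v) ->
    exists m n : rat, m != 0 /\ C * D = - ((n ^+ 2 + 3) / (4 * m ^+ 2)).
  move=> [[x y]] /(periodic_LLP _ _ _ hC) [conic _].
  have y0 : y != 0.
    apply/eqP => y0; have := sqr_ge0 (2 * C * x + 1).
    by move: conic; rewrite y0 expr0n mulr0; lra.
  by exists y, (2 * C * x + 1); split=> //; rewrite conic; field.
split; first split=> // -[m [n [m0 CD]]].
  by have [v _ per_v] := periodic_LL_seq hC m0 CD; exists (v 0%N).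
move=> /to_conic [m [n [m0 CD]]].
have [v v_inj per_v] := periodic_LL_seq hC m0 CD.
move=> /(finite_preimage (in2W v_inj)) fin; apply: infinite_nat.
by apply: sub_finite_set fin => k _; apply: per_v.
Qed.
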